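(* Let $A$ and $B$ be based spaces. There is a map $\Lambda : C(A * B) \to \Sigma A \times \Sigma B$ which carries the base $A*B$ of the cone into $\Sigma A\vee\Sigma B$ and such that, if $\lambda = \Lambda|_{A*B} : A * B \to \Sigma A\vee \Sigma B$ denotes the restriction, then: 1. $\lambda \mu \simeq \widetilde{k}:\Sigma (A \wedge B) \to \Sigma A \vee \Sigma B$, where $\widetilde k$ is the generalized Whitehead product map; 2. the map $\overline{\lambda}:\Sigma (A*B) \to \Sigma A \wedge \Sigma B$ induced by $\Lambda$ on the quotients $C(A*B)/(A*B)=\Sigma(A*B)$ and $(\Sigma A\times\Sigma B)/(\Sigma A\vee\Sigma B)=\Sigma A\wedge\Sigma B$ satisfies $\overline{\lambda}\simeq \sigma (\Sigma \mu '):\Sigma (A* B) \to \Sigma A \wedge \Sigma B$, where $\sigma: \Sigma ^2(A \wedge B) \to \Sigma A \wedge \Sigma B$ is the homeomorphism given by $\sigma ((a,b),t,u) =((a,t),(b,u))$ for $a\in A$, $b\in B$, $t,u \in I$.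
   Context: All spaces are based and of the homotopy type of based CW-complexes; maps and homotopies preserve base points. $I=[0,1]$; $\Sigma$ is the reduced suspension and $CX = X\times I/(\{*\}\times I\cup X\times\{1\})$ the reduced cone, with $X$ embedded as $X\times\{0\}$. The join $A*B$ is the quotient of $A\times B\times I$ by the relations $(a,b,0)\sim(a,b',0)$ and $(a,b,1)\sim(a',b,1)$, with $\{*\}\times\{*\}\times I$ collapsed to the base point. The map $\mu':A*B\to\Sigma(A\wedge B)$ is the homotopy equivalence obtained by collapsing (the image of) $(A\times\{*\}\times I)\cup(\{*\}\times B\times I)$ to a point, and $\mu:\Sigma(A\wedge B)\to A*B$ is a homotopy inverse of $\mu'$. Generalized Whitehead product: let $\alpha=[f]\in[\Sigma A,X]$ and $\beta=[g]\in[\Sigma B,X]$, let $p_1,p_2$ be the projections of $A\times B$ onto $A,B$, and set $f'=f(\Sigma p_1)$, $g'=g(\Sigma p_2)$ in the group $[\Sigma(A\times B),X]$ and $c=f'^{-1}g'^{-1}f'g'$. With $q:A\times B\to A\wedge B$ the quotient map, $[\alpha,\beta]\in[\Sigma(A\wedge B),X]$ is the unique element with $(\Sigma q)^*[\alpha,\beta]=c$. With $\iota_1:\Sigma A\to\Sigma A\vee\Sigma B$ and $\iota_2:\Sigma B\to\Sigma A\vee\Sigma B$ the inclusions, $\widetilde k:\Sigma(A\wedge B)\to\Sigma A\vee\Sigma B$ is a map in the homotopy class $[\iota_1,\iota_2]$, called the generalized Whitehead product map. *)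

(* Defs.v *)
From HB Require Import structures.
From mathcomp Require Import all_boot all_order all_algebra.
From mathcomp Require Import all_classical all_reals all_analysis.
From Stdlib Require Import Relation_Operators.

Set Implicit Arguments.
Unset Strict Implicit.
Unset Printing Implicit Defensive.

Import Order.TTheory GRing.Theory Num.Theory numFieldNormedType.Exports.
Local Open Scope classical_set_scope.
Local Open Scope ring_scope.
Local Open Scope quotient_scope.

(* Based spaces are [ptopologicalType]s, the base point being [point].
   Products carry the ordinary product topology. *)

HB.instance Definition _ (X Y : ptopologicalType) := Pointed.on (X * Y)%type.

Definition itv01 (R : realType) : set R := [set t | 0 <= t <= 1].
Definition unit_interval (R : realType) : Type := set_type (@itv01 R).

Section UnitInterval.
Context {R : realType}.
Local Notation I := (unit_interval R).

HB.instance Definition _ := Topological.copy I (set_type (@itv01 R)).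

Lemma clampP (r : R) :
  Num.max 0 (Num.min r 1) \in @itv01 R.
Proof.
by apply/mem_set; rewrite /itv01 /= le_max lexx /= ge_max ler01 /= ge_min lexx orbT.
Qed.

(* [clamp] is only used to build elements of the unit interval from reals that
   already lie in it. *)
Definition clamp (r : R) : I := exist (fun t => t \in @itv01 R) _ (clampP r).

Lemma clampE (r : R) : 0 <= r <= 1 -> set_val (clamp r) = r.
Proof. by case/andP => r0 r1; rewrite set_valE /= min_l// max_r. Qed.

Definition i0 : I := clamp 0.
Definition i1 : I := clamp 1.

HB.instance Definition _ := isPointed.Build I i0.

End UnitInterval.

(* The quotient of T by the equivalence relation generated by r, based at the
   class of the base point. *)
Section Glue.
Context {T : ptopologicalType} (r : T -> T -> Prop).

Definition glue_eq (x y : T) : bool := `[< clos_refl_sym_trans T r x y >].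

Lemma glue_eq_refl : reflexive glue_eq.
Proof. by move=> x; apply/asboolP; exact: rst_refl. Qed.

Lemma glue_eq_sym : symmetric glue_eq.
Proof.
by move=> x y; apply/idP/idP => /asboolP h; apply/asboolP; exact: rst_sym.
Qed.

Lemma glue_eq_trans : transitive glue_eq.
Proof.
move=> y x z /asboolP xy /asboolP yz; apply/asboolP; exact: rst_trans xy yz.
Qed.

Canonical glue_equiv := EquivRel glue_eq glue_eq_refl glue_eq_sym glue_eq_trans.

Definition glue : Type := quotient_topology {eq_quot glue_equiv}.

HB.instance Definition _ := PointedTopological.on glue.

Definition glue_pi (x : T) : glue := \pi_({eq_quot glue_equiv}) x.
Definition glue_repr (z : glue) : T := repr (z : {eq_quot glue_equiv}).

Lemma glue_piK (z : glue) : glue_pi (glue_repr z) = z.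
Proof. exact: reprK. Qed.

Lemma glue_pi_eq (x y : T) : r x y -> glue_pi x = glue_pi y.
Proof.
by move=> xy; apply/eqmodP/asboolP; exact: rst_step.
Qed.

(* Maps out of [glue] are written below as [g \o glue_repr]; this is the map
   induced by g as soon as g respects r. *)
Lemma glue_liftE (Z : Type) (g : T -> Z) :
  (forall x y, r x y -> g x = g y) ->
  forall x, g (glue_repr (glue_pi x)) = g x.
Proof.
move=> gr x.
have gE a b : clos_refl_sym_trans T r a b -> g a = g b.
  by elim=> [? ? /gr //|//|? ? _ ->//|? ? ? _ -> _ ->].
have /eqmodP/asboolP : glue_repr (glue_pi x) = x %[mod {eq_quot glue_equiv}].
  exact: reprK.
exact: gE.
Qed.

End Glue.

Arguments glue_pi {T r} x.

Definition collapse_rel (T : Type) (S : set T) (x y : T) : Prop := S x /\ S y.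
Definition collapse (T : ptopologicalType) (S : set T) : Type :=
  glue (collapse_rel S).
HB.instance Definition _ (T : ptopologicalType) (S : set T) :=
  PointedTopological.on (collapse S).

Lemma collapse_liftE (T : ptopologicalType) (S : set T) (Z : Type)
    (g : T -> Z) (z : Z) : (forall x, S x -> g x = z) ->
  forall x, g (glue_repr (glue_pi x : collapse S)) = g x.
Proof. by move=> gS; apply: glue_liftE => x y [/gS -> /gS ->]. Qed.

Definition based_map (X Y : ptopologicalType) (f : X -> Y) : Prop :=
  continuous f /\ f point = point.

Section Constructions.
Context {R : realType}.
Local Notation I := (unit_interval R).

Definition homotopic (X Y : ptopologicalType) (f g : X -> Y) : Prop :=
  exists H : X * I -> Y,
    [/\ continuous H, forall x, H (x, i0) = f x,
        forall x, H (x, i1) = g x & forall t, H (point, t) = point].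

Definition homotopy_inverse (X Y : ptopologicalType) (f : X -> Y) (g : Y -> X)
    : Prop :=
  [/\ based_map f, based_map g, homotopic (g \o f) id & homotopic (f \o g) id].

Definition susp_set (X : ptopologicalType) : set (X * I) :=
  [set p | [\/ p.1 = point, p.2 = i0 | p.2 = i1]].
Definition susp (X : ptopologicalType) : Type := collapse (@susp_set X).
HB.instance Definition _ (X : ptopologicalType) :=
  PointedTopological.on (susp X).
Definition susp_pi (X : ptopologicalType) (p : X * I) : susp X := glue_pi p.

Definition cone_set (X : ptopologicalType) : set (X * I) :=
  [set p | p.1 = point \/ p.2 = i1].
Definition cone (X : ptopologicalType) : Type := collapse (@cone_set X).
HB.instance Definition _ (X : ptopologicalType) :=
  PointedTopological.on (cone X).
Definition cone_pi (X : ptopologicalType) (p : X * I) : cone X := glue_pi p.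
Definition cone_base (X : ptopologicalType) (x : X) : cone X :=
  cone_pi (x, i0).

(* The wedge, as a subspace of the product. *)
Definition wedge_set (X Y : ptopologicalType) : set (X * Y) :=
  [set p | p.1 = point \/ p.2 = point].
Arguments wedge_set : clear implicits.
Definition wedge_sum (X Y : ptopologicalType) : Type :=
  set_type (wedge_set X Y).
HB.instance Definition _ (X Y : ptopologicalType) :=
  Topological.copy (wedge_sum X Y) (set_type (wedge_set X Y)).

Definition wedge_inl (X Y : ptopologicalType) (x : X) : wedge_sum X Y :=
  exist (fun p => p \in wedge_set X Y) (x, point)
    (mem_set (or_intror erefl : wedge_set X Y (x, point))).
Definition wedge_inr (X Y : ptopologicalType) (y : Y) : wedge_sum X Y :=
  exist (fun p => p \in wedge_set X Y) (point, y)
    (mem_set (or_introl erefl : wedge_set X Y (point, y))).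

HB.instance Definition _ (X Y : ptopologicalType) :=
  isPointed.Build (wedge_sum X Y) (wedge_inl Y point).

Definition wedge_val (X Y : ptopologicalType) (w : wedge_sum X Y) : X * Y :=
  set_val w.

Definition smash (X Y : ptopologicalType) : Type := collapse (wedge_set X Y).
HB.instance Definition _ (X Y : ptopologicalType) :=
  PointedTopological.on (smash X Y).
Definition smash_pi (X Y : ptopologicalType) (p : X * Y) : smash X Y :=
  glue_pi p.

Variant join_rel (A B : ptopologicalType) : A * B * I -> A * B * I -> Prop :=
| JoinLeft a b b' : join_rel (a, b, i0) (a, b', i0)
| JoinRight a a' b : join_rel (a, b, i1) (a', b, i1)
| JoinBase t t' : join_rel (point, point, t) (point, point, t').

Definition join_space (A B : ptopologicalType) : Type := glue (@join_rel A B).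
HB.instance Definition _ (A B : ptopologicalType) :=
  PointedTopological.on (join_space A B).
Definition join_pi (A B : ptopologicalType) (p : A * B * I) : join_space A B :=
  glue_pi p.

Lemma susp_piE (X : ptopologicalType) (p : X * I) :
  susp_set p -> susp_pi p = point.
Proof. by move=> Sp; apply: glue_pi_eq; split=> //; constructor. Qed.

Lemma smash_piE (X Y : ptopologicalType) (p : X * Y) :
  wedge_set X Y p -> smash_pi p = point.
Proof. by move=> Sp; apply: glue_pi_eq; split=> //; constructor. Qed.

Lemma cone_piE (X : ptopologicalType) (p : X * I) :
  cone_set p -> cone_pi p = point.
Proof. by move=> Sp; apply: glue_pi_eq; split=> //; constructor. Qed.

Definition susp_map (X Y : ptopologicalType) (f : X -> Y) (z : susp X)
    : susp Y :=
  let: (x, t) := glue_repr z in susp_pi (f x, t).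

Lemma susp_mapE (X Y : ptopologicalType) (f : X -> Y) x t :
  f point = point -> susp_map f (susp_pi (x, t)) = susp_pi (f x, t).
Proof.
move=> f0; pose F (p : X * I) := let: (x, t) := p in susp_pi (f x, t).
rewrite -[LHS]/(F (glue_repr (susp_pi (x, t)))) -[RHS]/(F (x, t)).
apply: (@collapse_liftE _ (@susp_set X) _ F point).
move=> [a s] /= Sas; apply: susp_piE.
by case: Sas => /= ->; rewrite ?f0; [constructor 1|constructor 2|constructor 3].
Qed.

(* The operations of the group of homotopy classes from the suspension of X to
   Y, on representatives: in [susp_mul f g], f is run through first. *)
Definition susp_mul (X Y : ptopologicalType) (f g : susp X -> Y) (z : susp X)
    : Y :=
  let: (x, t) := glue_repr z in
  if set_val t <= 2^-1 then f (susp_pi (x, clamp (2 * set_val t)))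
  else g (susp_pi (x, clamp (2 * set_val t - 1))).

Definition susp_inv (X Y : ptopologicalType) (f : susp X -> Y) (z : susp X)
    : Y :=
  let: (x, t) := glue_repr z in f (susp_pi (x, clamp (1 - set_val t))).

Lemma susp_mulE (X Y : ptopologicalType) (f g : susp X -> Y) x t :
  f point = point -> g point = point ->
  susp_mul f g (susp_pi (x, t)) =
  if set_val t <= 2^-1 then f (susp_pi (x, clamp (2 * set_val t)))
  else g (susp_pi (x, clamp (2 * set_val t - 1))).
Proof.
move=> f0 g0; pose F (p : X * I) := let: (x, t) := p in
  if set_val t <= 2^-1 then f (susp_pi (x, clamp (2 * set_val t)))
  else g (susp_pi (x, clamp (2 * set_val t - 1))).
rewrite -[LHS]/(F (glue_repr (susp_pi (x, t)))) -[RHS]/(F (x, t)).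
apply: (@collapse_liftE _ (@susp_set X) _ F point).
move=> [a s] /=; case=> /= ->.
- by case: ifP => _; rewrite susp_piE//; constructor 1.
- rewrite clampE ?lexx ?ler01// invr_ge0 ler0n mulr0 susp_piE//.
  by constructor 2.
- rewrite clampE ?lexx ?ler01// leNgt invf_lt1 ?ltr1n//= mulr1 susp_piE//.
  constructor 3; rewrite /i1 /=; congr clamp.
  by rewrite -[2]/(1 + 1 : R) addrK.
Qed.

Lemma susp_invE (X Y : ptopologicalType) (f : susp X -> Y) x t :
  f point = point ->
  susp_inv f (susp_pi (x, t)) = f (susp_pi (x, clamp (1 - set_val t))).
Proof.
move=> f0; pose F (p : X * I) :=
  let: (x, t) := p in f (susp_pi (x, clamp (1 - set_val t))).
rewrite -[LHS]/(F (glue_repr (susp_pi (x, t)))) -[RHS]/(F (x, t)).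
apply: (@collapse_liftE _ (@susp_set X) _ F point).
move=> [a s] /=; case=> /= ->.
- by rewrite susp_piE//; constructor 1.
- by rewrite clampE ?lexx ?ler01// subr0 susp_piE//; constructor 3.
- by rewrite clampE ?lexx ?ler01// subrr susp_piE//; constructor 2.
Qed.

Definition susp_comm (X Y : ptopologicalType) (f g : susp X -> Y)
    : susp X -> Y :=
  susp_mul (susp_mul (susp_mul (susp_inv f) (susp_inv g)) f) g.

(* The generalized Whitehead product of the classes of f and g, given as the
   set of the maps representing it.  That these maps form exactly one homotopy
   class is not part of the definition. *)
Definition whitehead_product (A B X : ptopologicalType)
    (f : susp A -> X) (g : susp B -> X) : set (susp (smash A B) -> X) :=
  [set w | based_map w /\
    homotopic (w \o susp_map (@smash_pi A B))
      (susp_comm (f \o susp_map (fst : A * B -> A))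
                 (g \o susp_map (snd : A * B -> B)))].

Definition whitehead_maps (A B : ptopologicalType)
    : set (susp (smash A B) -> wedge_sum (susp A) (susp B)) :=
  whitehead_product (@wedge_inl (susp A) (susp B))
                    (@wedge_inr (susp A) (susp B)).

Definition mu' (A B : ptopologicalType) (z : join_space A B)
    : susp (smash A B) :=
  let: (a, b, t) := glue_repr z in susp_pi (smash_pi (a, b), t).

Lemma mu'E (A B : ptopologicalType) (a : A) (b : B) t :
  mu' (join_pi (a, b, t)) = susp_pi (smash_pi (a, b), t).
Proof.
pose F (p : A * B * I) := let: (a, b, t) := p in susp_pi (smash_pi (a, b), t).
rewrite -[LHS]/(F (glue_repr (join_pi (a, b, t)))) -[RHS]/(F (a, b, t)).
apply: (@glue_liftE _ (@join_rel A B) _ F).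
move=> _ _ [a1 b1 b2|a1 a2 b1|s s']; rewrite /F.
- by rewrite !susp_piE//; constructor 2.
- by rewrite !susp_piE//; constructor 3.
- by rewrite !susp_piE//; constructor 1.
Qed.

Definition sigma (A B : ptopologicalType) (z : susp (susp (smash A B)))
    : smash (susp A) (susp B) :=
  let: (y, u) := glue_repr z in
  let: (s, t) := glue_repr y in
  let: (a, b) := glue_repr s in
  smash_pi (susp_pi (a, t), susp_pi (b, u)).

Lemma sigmaE (A B : ptopologicalType) (a : A) (b : B) t u :
  sigma (susp_pi (susp_pi (smash_pi (a, b), t), u)) =
  smash_pi (susp_pi (a, t), susp_pi (b, u)).
Proof.
pose F1 u t (p : A * B) :=
  let: (a, b) := p in smash_pi (susp_pi (a, t), susp_pi (b, u)).
have F1E u1 t1 p : F1 u1 t1 (glue_repr (smash_pi p)) = F1 u1 t1 p.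
  apply: (@collapse_liftE _ (wedge_set A B) _ (F1 u1 t1) point) => -[a1 b1] /= ab.
  by apply: smash_piE; case: ab => /= ->; [left|right];
    rewrite /= susp_piE//; constructor 1.
pose F2 u (q : smash A B * I) := let: (s, t) := q in F1 u t (glue_repr s).
have F2S u1 q : susp_set q -> F2 u1 q = point.
  case: q => s t1; rewrite /F2 -(glue_piK s); case: (glue_repr s) => a1 b1.
  rewrite -/(smash_pi (a1, b1)) => st; rewrite (F1E u1 t1 (a1, b1)).
  case: st => h; rewrite /= in h.
  - rewrite -(F1E u1 t1 (a1, b1)) h (F1E u1 t1 (point, point)).
    by apply: smash_piE; left; rewrite /= susp_piE//; constructor 1.
  - by apply: smash_piE; left; rewrite /= h susp_piE//; constructor 2.
  - by apply: smash_piE; left; rewrite /= h susp_piE//; constructor 3.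
have F2E u1 q : F2 u1 (glue_repr (susp_pi q)) = F2 u1 q.
  exact: (@collapse_liftE _ (@susp_set (smash A B)) _ (F2 u1) point (F2S u1)).
pose F3 (q : susp (smash A B) * I) := let: (y, u) := q in F2 u (glue_repr y).
have F3E q : F3 (glue_repr (susp_pi q)) = F3 q.
  apply: (@collapse_liftE _ (@susp_set (susp (smash A B))) _ F3 point) => -[y u1] /=.
  rewrite -(glue_piK y); case: (glue_repr y) => s t1.
  rewrite -/(susp_pi (s, t1)) -(glue_piK s); case: (glue_repr s) => a1 b1.
  rewrite -/(smash_pi (a1, b1)) => h; rewrite (F2E u1 (_, t1)).
  case: h => h; rewrite /= in h.
  - by rewrite -(F2E u1 (_, t1)) h (F2E u1 point) F2S//; constructor 1.
  - rewrite /F2 (F1E u1 t1 (a1, b1)); apply: smash_piE; right.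
    by rewrite /= h susp_piE//; constructor 2.
  - rewrite /F2 (F1E u1 t1 (a1, b1)); apply: smash_piE; right.
    by rewrite /= h susp_piE//; constructor 3.
rewrite -[LHS]/(F3 (glue_repr (susp_pi (susp_pi (smash_pi (a, b), t), u)))).
by rewrite (F3E (_, u)) /F3 (F2E u (_, t)) /F2 (F1E u t (a, b)).
Qed.

(* The map from the suspension of Z, seen as the cone of Z modulo its base, to
   the smash product, seen as the product modulo the wedge, induced by L. *)
Definition cofiber_map (Z X Y : ptopologicalType) (L : cone Z -> X * Y)
    (z : susp Z) : smash X Y :=
  smash_pi (L (cone_pi (glue_repr z))).

Lemma cofiber_mapE (Z X Y : ptopologicalType) (L : cone Z -> X * Y) :
  L point = point -> (forall z, wedge_set X Y (L (cone_base z))) ->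
  forall p, cofiber_map L (susp_pi p) = smash_pi (L (cone_pi p)).
Proof.
move=> L0 Lw; apply: (@collapse_liftE _ _ _
  (fun p => smash_pi (L (cone_pi p))) point) => -[z t] /= [] /= ->.
- by rewrite cone_piE ?L0//; left.
- exact/smash_piE/Lw.
- by rewrite cone_piE ?L0//; right.
Qed.

End Constructions.

Arguments unit_interval : clear implicits.
Arguments susp R X : clear implicits.
Arguments cone R X : clear implicits.
Arguments join_space R A B : clear implicits.
Arguments mu' R A B : clear implicits.
Arguments sigma R A B : clear implicits.
Arguments whitehead_maps R A B : clear implicits.
Arguments homotopic R {X Y} f g.
Arguments homotopy_inverse R {X Y} f g.

Section CWComplex.
Context (R : realType).

Definition disc n : set 'rV[R]_n := [set x | \sum_i x 0 i ^+ 2 <= 1].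
Definition open_disc n : set 'rV[R]_n := [set x | \sum_i x 0 i ^+ 2 < 1].
Definition disc_sphere n : set 'rV[R]_n := [set x | \sum_i x 0 i ^+ 2 = 1].

Arguments disc n : clear implicits.

(* [cell n] indexes the n-cells; only the values of [char_map e] on the closed
   disc matter.  The base point is required to be a vertex. *)
Record CW_structure (K : ptopologicalType) := CWStructure {
  cell : nat -> Type;
  char_map : forall n, cell n -> 'rV[R]_n -> K;
  CW_hausdorff : hausdorff_space K;
  char_map_continuous : forall n (e : cell n),
    {within disc n, continuous (char_map e)};
  CW_partition : forall x : K,
    exists! c : {n : nat & (cell n * 'rV[R]_n)%type},
      open_disc (projT2 c).2 /\ char_map (projT2 c).1 (projT2 c).2 = x;
  CW_closure_finite : forall n (e : cell n),
    exists S : set {m : nat & cell m},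
      [/\ finite_set S, forall c, S c -> (projT1 c < n)%N &
          forall x, disc_sphere x -> exists c y,
            [/\ S c, open_disc y & char_map (projT2 c) y = char_map e x]];
  CW_weak_topology : forall C : set K,
    (forall n (e : cell n), closed (disc n `&` char_map e @^-1` C)) ->
    closed C;
  CW_vertex : exists e : cell 0, char_map e 0 = point
}.

Definition based_CW_type (X : ptopologicalType) : Prop :=
  exists (K : ptopologicalType) (_ : CW_structure K) (f : X -> K) (g : K -> X),
    homotopy_inverse R f g.

End CWComplex.

(* Main.v *)
Require Import Defs.
From mathcomp Require Import all_boot all_order all_algebra.
From mathcomp Require Import all_classical all_reals all_analysis.
From mathcomp Require Import ring lra.

Set Implicit Arguments.
Unset Strict Implicit.
Unset Printing Implicit Defensive.

Import Order.TTheory GRing.Theory Num.Theory numFieldNormedType.Exports.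
Local Open Scope classical_set_scope.
Local Open Scope ring_scope.

(** Represent a map out of A * B by the two suspension coordinates (u, v) that
    it gives to (a, b, t): the image of (a, b, t) is then the pair of the
    classes of (a, u) and (b, v).  It lies in the wedge as soon as u or v is 0
    or 1, and it is well defined on the join as soon as v is 0 or 1 for t = 0
    and u is 0 or 1 for t = 1.

    The map Lambda sends ((a, b, t), s) to the point with coordinates
    u = 2t + 2s - 1 and v = 1 - 2t + 2s, truncated to [0,1].  On the base s = 0
    this is lambda: run backwards through the loop of b while t <= 1/2, then
    forwards through the loop of a.  So lambda is the loop product g'^-1 f'
    pulled back along the map p : A * B -> S(A x B) that collapses the two ends
    of the join.

    Part 1 rests on the factorization mu' = (S q) p ([mu'_factor]).  If k is a
    Whitehead product map, then k (S q) is homotopic to the commutator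
    c = f'^-1 g'^-1 f' g', so k mu' is homotopic to c p.  On A * B the first
    factor f'^-1 of c can be undone from the end t = 0, where b is forgotten,
    and the last factor g' from the end t = 1, where a is forgotten: sliding
    the two ends of the loop c inwards ([comm_join_homotopic]) gives a homotopy
    from c p to g'^-1 f', that is to lambda.  Hence
    lambda mu ~ c p mu ~ k mu' mu ~ k ([lambda_whitehead]).

    For part 2, the map (t, s) |-> (u, v) sends the boundary of the square to
    itself with degree one: it turns the square by one eighth of a turn, scales
    it and shifts it.  Doing this gradually, without ever moving a boundary
    point into the interior ([turn_boundary]), is a homotopy from the identity,
    which describes sigma (S mu'), to the map induced by Lambda
    ([cofiber_map_Lambda]).

    The homotopies are written on A x B x I x I x I and descend to the
    quotients because the product of a quotient map with the identity of the
    locally compact space I is again a quotient map ([quotient_map_prod]). *)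

(** * Continuous maps and the unit interval *)

Lemma continuous_pair (X Y Z : topologicalType) (f : X -> Y) (g : X -> Z) :
  continuous f -> continuous g -> continuous (fun x => (f x, g x)).
Proof. by move=> cf cg x; apply: cvg_pair; [exact: cf|exact: cg]. Qed.

Lemma continuous_then (X Y Z : topologicalType) (f : X -> Y) (g : Y -> Z) :
  continuous f -> continuous g -> continuous (fun x => g (f x)).
Proof. by move=> cf cg x; apply: continuous_comp; [exact: cf|exact: cg]. Qed.

Lemma continuous_fst (X Y : topologicalType) : continuous (@fst X Y).
Proof. by move=> x; exact: cvg_fst. Qed.

Lemma continuous_snd (X Y : topologicalType) : continuous (@snd X Y).
Proof. by move=> x; exact: cvg_snd. Qed.

Section Interval.
Context {R : realType}.
Local Notation I := (unit_interval R).

Lemma set_val_continuous : continuous (set_val : I -> R).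
Proof. exact: (@initial_continuous I R set_val). Qed.

Lemma clamp_continuous : continuous (clamp : R -> I).
Proof.
apply: (@continuous_comp_initial I R R set_val) => x /=.
apply: (@continuous_max R R (cst 0) (fun x => Num.min x 1)); first exact: cvg_cst.
by apply: (@continuous_min R R id (cst 1)); [exact: cvg_id|exact: cvg_cst].
Qed.

Lemma set_val_itv (t : I) : 0 <= set_val t <= 1.
Proof. by case: t => t ht; rewrite set_valE /=; move: (set_mem ht). Qed.

Lemma clampK (t : I) : clamp (set_val t) = t.
Proof. by apply: val_inj; rewrite -[LHS]/(set_val _) clampE// set_val_itv. Qed.

Lemma clamp_le0 (x : R) : x <= 0 -> clamp x = i0.
Proof.
move=> x0; apply: val_inj; rewrite /=.
by rewrite min_l ?(le_trans x0)// max_l// min_l// max_l.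
Qed.

Lemma clamp_ge1 (x : R) : 1 <= x -> clamp x = i1.
Proof.
move=> x1; apply: val_inj; rewrite /=.
by rewrite min_r// min_r.
Qed.

Lemma set_val_i0 : set_val (i0 : I) = 0.
Proof. by rewrite clampE// lexx ler01. Qed.

Lemma set_val_i1 : set_val (i1 : I) = 1.
Proof. by rewrite clampE// lexx ler01. Qed.

(** The compact neighbourhoods are images under [clamp] of segments of the real
    line: [clamp] retracts the line onto the interval. *)
Lemma unit_interval_locally_compact (t : I) (V : set I) :
  nbhs t V -> exists K, [/\ nbhs t K, compact K & K `<=` V].
Proof.
move=> tV.
have : nbhs (set_val t) (clamp @^-1` V).
  by apply: clamp_continuous; rewrite clampK.
move=> /nbhs_ballP [e /= e0 eV].
pose K0 := `[set_val t - e / 2, set_val t + e / 2]%classic.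
exists (clamp @` K0); split.
- have : nbhs t (set_val @^-1` K0).
    apply: set_val_continuous; apply/nbhs_ballP; exists (e / 2) => /=.
      by rewrite divr_gt0.
    move=> x; rewrite -ball_normE /K0 /= in_itv /= ltr_distlC => /andP[h1 h2].
    by rewrite !ltW.
  by apply: filterS => s K0s; exists (set_val s) => //; exact: clampK.
- apply: continuous_compact; last exact: segment_compact.
  exact: continuous_subspaceT clamp_continuous.
- move=> _ [x K0x <-]; apply: eV; rewrite -ball_normE /= ltr_distlC.
  by move: K0x; rewrite /K0 /= in_itv /= => /andP[h1 h2]; apply/andP; split; lra.
Qed.
End Interval.

(** * Quotient maps *)

Definition quotient_map (X Y : topologicalType) (p : X -> Y) : Prop :=
  [/\ continuous p, forall y, exists x, p x = y
    & forall U, open (p @^-1` U) -> open U].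

Lemma quotient_map_continuous (X Y Z : topologicalType) (p : X -> Y) (f : Y -> Z) :
  quotient_map p -> continuous (f \o p) -> continuous f.
Proof.
move=> [_ _ qp] /continuousP cf; apply/continuousP => U oU.
by apply: qp; rewrite -comp_preimage; exact: cf.
Qed.

Lemma quotient_map_comp (X Y Z : topologicalType) (p : X -> Y) (q : Y -> Z) :
  quotient_map p -> quotient_map q -> quotient_map (q \o p).
Proof.
move=> [cp sp qp] [cq sq qq]; split.
- exact: continuous_then.
- by move=> z; have [y <-] := sq z; have [x <-] := sp y; exists x.
- by move=> U oU; apply/qq/qp; rewrite -comp_preimage.
Qed.

Lemma quotient_map_glue (T : ptopologicalType) (r : T -> T -> Prop) :
  quotient_map (glue_pi : T -> Defs.glue r).
Proof.
split; first exact: pi_continuous.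
- by move=> y; exists (glue_repr y); exact: glue_piK.
- by [].
Qed.

(** J. H. C. Whitehead's lemma.  Around a point (p x, t) of a set W with open
    preimage, choose a compact neighbourhood K of t with {x} x K in the
    preimage.  The points y with {y} x K in W form a set whose preimage is open
    by the tube lemma, hence an open set U, and U x K is a neighbourhood of
    (p x, t) contained in W. *)
Lemma quotient_map_prod (X Y L : topologicalType) (p : X -> Y) :
  (forall (t : L) (V : set L), nbhs t V ->
     exists K, [/\ nbhs t K, compact K & K `<=` V]) ->
  quotient_map p -> quotient_map (fun z : X * L => (p z.1, z.2)).
Proof.
move=> lcL [cp sp qp]; split.
- apply: continuous_pair; last exact: continuous_snd.
  exact: continuous_then (@continuous_fst _ _) cp.
- by move=> [y t]; have [x <-] := sp y; exists (x, t).
move=> W oW; rewrite openE => -[y t] Wyt.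
have [x xy] := sp y.
have oWxt z : W (p z.1, z.2) -> nbhs z ((fun z : X * L => (p z.1, z.2)) @^-1` W).
  by move=> Wz; exact: open_nbhs_nbhs.
have [[P V] /= [xP tV] PVW] : nbhs (x, t) ((fun z : X * L => (p z.1, z.2)) @^-1` W).
  by apply: oWxt; rewrite /= xy.
have [K [tK cK KV]] := lcL _ _ tV.
pose U := [set y' | forall t', K t' -> W (y', t')].
have oU : open U.
  apply: qp; rewrite openE => x' Ux'.
  (* the tube lemma *)
  have : \near x', K `<=` (fun t' => W (p x', t')).
    move/compact_near_coveringP : cK; apply => t' /Ux' Wt'.
    have [[P' V'] /= [xP' tV'] PVW'] := oWxt (x', t') Wt'.
    exists (V', P') => //= -[t'' x''] [/= V't'' P'x''].
    by apply: (PVW' (x'', t'')).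
  by apply: filterS => x'' h t'' /h.
exists (U, K) => /=; last by move=> [y' t'] [/= Uy' Kt']; exact: Uy'.
split=> //; apply: open_nbhs_nbhs; split=> // t' /KV Vt'.
by rewrite -xy; apply: (PVW (x, t')); split=> //=; exact: nbhs_singleton.
Qed.

(** * Homotopies *)

Section Homotopy.
Context {R : realType}.
Local Notation I := (unit_interval R).

Lemma continuous_if_le (X Y : topologicalType) (h : X -> R) (c : R)
    (f g : X -> Y) :
  continuous h -> continuous f -> continuous g ->
  (forall x, h x = c -> f x = g x) ->
  continuous (fun x => if h x <= c then f x else g x).
Proof.
move=> ch cf cg fg; apply/continuous_subspace_setT.
have -> : [set: X] = (h @^-1` [set y | y <= c]) `|` (h @^-1` [set y | c <= y]).
  by apply/seteqP; split=> // x _ /=; case: (leP (h x) c) => [|/ltW]; [left|right].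
apply: withinU_continuous.
- by move/continuous_closedP : ch; apply; exact: closed_le.
- by move/continuous_closedP : ch; apply; exact: closed_ge.
- apply: (@subspace_eq_continuous _ _ _ f); last exact: continuous_subspaceT.
  by move=> x /set_mem /= hx; rewrite /from_subspace hx.
- apply: (@subspace_eq_continuous _ _ _ g); last exact: continuous_subspaceT.
  move=> x /set_mem /= cx; rewrite /from_subspace; case: ifPn => // hx.
  by rewrite fg//; apply/eqP; rewrite eq_le hx cx.
Qed.

Lemma homotopic_sym (X Y : ptopologicalType) (f g : X -> Y) :
  homotopic R f g -> homotopic R g f.
Proof.
move=> [H [cH H0 H1 Hp]]; exists (fun z : X * I => H (z.1, clamp (1 - set_val z.2))).
split=> [|x|x|t] //=.
- apply: (@continuous_then _ _ _ (fun z : X * I => (z.1, clamp (1 - set_val z.2))) H) => //.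
  apply: continuous_pair; first exact: continuous_fst.
  apply: continuous_then (@clamp_continuous R).
  move=> z; apply: cvgB; first exact: cvg_cst.
  exact: (continuous_then (@continuous_snd _ _) (@set_val_continuous R)).
- by rewrite set_val_i0 subr0 clamp_ge1// H1.
- by rewrite set_val_i1 subrr clamp_le0// H0.
Qed.

Lemma homotopic_trans (X Y : ptopologicalType) (f g h : X -> Y) :
  homotopic R f g -> homotopic R g h -> homotopic R f h.
Proof.
move=> [H [cH H0 H1 Hp]] [K [cK K0 K1 Kp]].
have cval : continuous (fun z : X * I => set_val z.2).
  exact: (continuous_then (@continuous_snd _ _) (@set_val_continuous R)).
exists (fun z : X * I => if set_val z.2 <= 2^-1 then H (z.1, clamp (2 * set_val z.2))
                 else K (z.1, clamp (2 * set_val z.2 - 1))).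
split=> [|x|x|t] /=.
- apply: continuous_if_le => //.
  + apply: (@continuous_then _ _ _ (fun z : X * I => (z.1, clamp (2 * set_val z.2))) H) => //.
    apply: continuous_pair; first exact: continuous_fst.
    apply: continuous_then (@clamp_continuous R) => z.
    by apply: cvgM; [exact: cvg_cst|exact: cval].
  + apply: (@continuous_then _ _ _
        (fun z : X * I => (z.1, clamp (2 * set_val z.2 - 1))) K) => //.
    apply: continuous_pair; first exact: continuous_fst.
    apply: continuous_then (@clamp_continuous R) => z.
    apply: cvgB; last exact: cvg_cst.
    by apply: cvgM; [exact: cvg_cst|exact: cval].
  + move=> [x t] /= ->; rewrite divff// subrr clamp_ge1// clamp_le0//.
    by rewrite H1 K0.
- by rewrite set_val_i0 mulr0 clamp_le0// invr_ge0 ler0n.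
- rewrite set_val_i1 mulr1 ifF; first by rewrite clamp_ge1 ?K1//; lra.
  by apply/negbTE; rewrite -ltNge; lra.
- by case: ifP.
Qed.

Lemma homotopic_postcomp (X Y Z : ptopologicalType) (f g : X -> Y) (k : Y -> Z) :
  based_map k -> homotopic R f g -> homotopic R (k \o f) (k \o g).
Proof.
move=> [ck k0] [H [cH H0 H1 Hp]]; exists (k \o H); split=> [|x|x|t] /=.
- exact: continuous_then.
- by rewrite H0.
- by rewrite H1.
- by rewrite Hp.
Qed.

Lemma homotopic_precomp (X Y Z : ptopologicalType) (f g : Y -> Z) (k : X -> Y) :
  based_map k -> homotopic R f g -> homotopic R (f \o k) (g \o k).
Proof.
move=> [ck k0] [H [cH H0 H1 Hp]]; exists (fun z : X * I => H (k z.1, z.2)).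
split=> [|x|x|t] //=; last by rewrite k0.
apply: (@continuous_then _ _ _ (fun z : X * I => (k z.1, z.2)) H) => //.
apply: continuous_pair; last exact: continuous_snd.
exact: continuous_then (@continuous_fst _ _) ck.
Qed.

(** The continuity of H may be tested on X x I, because Y x I is a quotient of
    it. *)
Lemma homotopic_quotient (X Y Z : ptopologicalType) (p : X -> Y)
    (H : Y * I -> Z) (f g : Y -> Z) :
  quotient_map p ->
  continuous (fun z : X * I => H (p z.1, z.2)) ->
  (forall x, H (p x, i0) = f (p x)) -> (forall x, H (p x, i1) = g (p x)) ->
  (forall t, H (point, t) = point) ->
  homotopic R f g.
Proof.
move=> qp cH H0 H1 Hp; have [_ sp _] := qp.
exists H; split=> [|y|y|//].
- apply: quotient_map_continuous cH.
  exact: quotient_map_prod unit_interval_locally_compact qp.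
- by have [x <-] := sp y.
- by have [x <-] := sp y.
Qed.

End Homotopy.

(** * Suspensions and the commutator *)

Section Suspension.
Context {R : realType}.
Local Notation I := (unit_interval R).

Lemma susp_point (X : ptopologicalType) :
  point = susp_pi (point, i0) :> susp R X.
Proof. by []. Qed.

Lemma cone_point (X : ptopologicalType) :
  point = cone_pi (point, i0) :> cone R X.
Proof. by []. Qed.

Lemma smash_point (X Y : ptopologicalType) : point = smash_pi point :> smash X Y.
Proof. by []. Qed.

Lemma susp_pi_i0 (X : ptopologicalType) (x : X) : susp_pi (x, i0) = point :> susp R X.
Proof. by rewrite susp_piE//; constructor 2. Qed.

Lemma susp_pi_i1 (X : ptopologicalType) (x : X) : susp_pi (x, i1) = point :> susp R X.
Proof. by rewrite susp_piE//; constructor 3. Qed.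

Lemma susp_pi_point (X : ptopologicalType) t : susp_pi (point, t) = point :> susp R X.
Proof. by rewrite susp_piE//; constructor 1. Qed.

Lemma susp_pi_continuous (X : ptopologicalType) : continuous (@susp_pi R X).
Proof. by case: (quotient_map_glue (collapse_rel (@susp_set R X))). Qed.

Lemma continuous_susp_pi (X : topologicalType) (Y : ptopologicalType)
  (f : X -> Y) (g : X -> R) :
  continuous f -> continuous g ->
  continuous (fun x => susp_pi (f x, clamp (g x))).
Proof.
move=> cf cg.
apply: (@continuous_then _ _ _ (fun x => (f x, clamp (g x))) (@susp_pi R Y));
  last exact: susp_pi_continuous.
apply: continuous_pair => //; exact: continuous_then (@clamp_continuous R).
Qed.

Lemma susp_mul_left (X Y : ptopologicalType) (f g : susp R X -> Y) y x :
  f point = point -> g point = point -> x <= 2^-1 ->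
  susp_mul f g (susp_pi (y, clamp x)) = f (susp_pi (y, clamp (2 * x))).
Proof.
move=> f0 g0 hx; rewrite susp_mulE//; have [x0|x0] := leP x 0.
  by rewrite (clamp_le0 x0) set_val_i0 invr_ge0 ler0n mulr0 !clamp_le0//; lra.
by rewrite clampE ?hx//; lra.
Qed.

Lemma susp_mul_right (X Y : ptopologicalType) (f g : susp R X -> Y) y x :
  f point = point -> g point = point -> 2^-1 <= x ->
  susp_mul f g (susp_pi (y, clamp x)) = g (susp_pi (y, clamp (2 * x - 1))).
Proof.
move=> f0 g0; rewrite le_eqVlt => /predU1P[<-|hx].
  rewrite susp_mul_left// divff// subrr (clamp_le0 (lexx 0)) clamp_ge1//.
  by rewrite !susp_piE ?f0 ?g0//; [constructor 2|constructor 3].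
rewrite susp_mulE//; have [x1|x1] := leP 1 x.
  rewrite (clamp_ge1 x1) set_val_i1 ifF; last by apply/negbTE; rewrite -ltNge; lra.
  by rewrite !clamp_ge1//; lra.
rewrite clampE; last lra.
by rewrite ifF//; apply/negbTE; rewrite -ltNge.
Qed.

Lemma susp_inv_clamp (X Y : ptopologicalType) (f : susp R X -> Y) y x :
  f point = point ->
  susp_inv f (susp_pi (y, clamp x)) = f (susp_pi (y, clamp (1 - x))).
Proof.
move=> f0; rewrite susp_invE//; have [x0|x0] := leP x 0.
  by rewrite (clamp_le0 x0) set_val_i0 !clamp_ge1//; lra.
have [x1|x1] := leP 1 x; last by rewrite clampE//; lra.
by rewrite (clamp_ge1 x1) set_val_i1 !clamp_le0//; lra.
Qed.

Lemma susp_mul_point (X Y : ptopologicalType) (f g : susp R X -> Y) :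
  f point = point -> g point = point -> susp_mul f g point = point.
Proof.
move=> f0 g0; rewrite {1}susp_point.
by rewrite susp_mul_left ?susp_pi_point// invr_ge0.
Qed.

Lemma susp_inv_point (X Y : ptopologicalType) (f : susp R X -> Y) :
  f point = point -> susp_inv f point = point.
Proof.
by move=> f0; rewrite {1}susp_point susp_inv_clamp// susp_pi_point.
Qed.

Lemma susp_map_point (X Y : ptopologicalType) (f : X -> Y) :
  f point = point -> susp_map f (point : susp R X) = point.
Proof.
by move=> f0; rewrite {1}susp_point susp_mapE// f0.
Qed.

(** The product in [susp_comm] is bracketed to the left, so the four factors are
    run through on [0,1/8], [1/8,1/4], [1/4,1/2] and [1/2,1].  The truncation
    [clamp] makes the outer two formulas valid beyond [0,1], and the base point
    reconciles them at the three division points. *)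
Lemma susp_commE (X Y : ptopologicalType) (f g : susp R X -> Y) y x :
  f point = point -> g point = point ->
  [/\ x <= 1 / 8 ->
        susp_comm f g (susp_pi (y, clamp x)) = f (susp_pi (y, clamp (1 - 8 * x))),
      1 / 8 <= x <= 1 / 4 ->
        susp_comm f g (susp_pi (y, clamp x)) = g (susp_pi (y, clamp (2 - 8 * x))),
      1 / 4 <= x <= 1 / 2 ->
        susp_comm f g (susp_pi (y, clamp x)) = f (susp_pi (y, clamp (4 * x - 1)))
    & 1 / 2 <= x ->
        susp_comm f g (susp_pi (y, clamp x)) = g (susp_pi (y, clamp (2 * x - 1)))].
Proof.
move=> f0 g0; have if0 := susp_inv_point f0; have ig0 := susp_inv_point g0.
have m1 := susp_mul_point if0 ig0; have m2 := susp_mul_point m1 f0.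
rewrite /susp_comm; split=> hx.
- do 3 (rewrite susp_mul_left//; last lra).
  by rewrite susp_inv_clamp//; congr (f (susp_pi (y, clamp _))); lra.
- do 2 (rewrite susp_mul_left//; last lra).
  rewrite susp_mul_right//; last lra.
  by rewrite susp_inv_clamp//; congr (g (susp_pi (y, clamp _))); lra.
- rewrite susp_mul_left//; last lra.
  rewrite susp_mul_right//; last lra.
  by congr (f (susp_pi (y, clamp _))); lra.
- by rewrite susp_mul_right//; lra.
Qed.
End Suspension.

(** * The join and the map lambda *)

Lemma wedge_inr_point (X Y : ptopologicalType) :
  wedge_inr X (point : Y) = point.
Proof. exact: val_inj. Qed.

Section Join.
Context {R : realType} {A B : ptopologicalType}.
Local Notation I := (unit_interval R).
Local Notation J := (join_space R A B).

Definition join_lift (Z : Type) (F : A * B * I -> Z) (z : J) : Z :=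
  F (glue_repr z).

Lemma join_liftE (Z : Type) (F : A * B * I -> Z) :
  (forall p q, join_rel p q -> F p = F q) ->
  forall p, join_lift F (join_pi p) = F p.
Proof. by move=> Fr p; apply: (@glue_liftE _ (@join_rel R A B) _ F). Qed.

Lemma join_point : point = join_pi (point, point, i0) :> J.
Proof. by []. Qed.

(** Both the cone and the suspension of the join are collapsed cylinders, so
    this covers the maps out of either. *)
Definition cylinder_lift (S : set (J * I)) (Z : Type)
    (F : A * B * I -> I -> Z) (z : collapse S) : Z :=
  join_lift (F ^~ (glue_repr z).2) (glue_repr z).1.

Lemma cylinder_liftE (S : set (J * I)) (Z : Type) (z0 : Z)
    (F : A * B * I -> I -> Z) :
  (forall s p q, join_rel p q -> F p s = F q s) ->
  (forall p s, S (join_pi p, s) -> F p s = z0) ->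
  forall p s, cylinder_lift F (glue_pi (join_pi p, s) : collapse S) = F p s.
Proof.
move=> Fr FS p s.
pose G (q : J * I) := join_lift (F ^~ q.2) q.1.
rewrite -[RHS](join_liftE (Fr s)) -[LHS]/(G (glue_repr _)).
rewrite (@collapse_liftE _ S _ G z0)// => -[y t] Syt.
rewrite /G -(glue_piK y) /= join_liftE; last exact: Fr.
by apply: FS; rewrite /join_pi glue_piK.
Qed.

Lemma join_pi_point (Z : Type) (F : A * B * I -> Z) p :
  (forall p q, join_rel p q -> F p = F q) ->
  join_pi p = point -> F p = F (point, point, i0).
Proof. by move=> Fr pE; rewrite -(join_liftE Fr) pE join_point join_liftE. Qed.

Lemma quotient_map_join : quotient_map (@join_pi R A B).
Proof. exact: quotient_map_glue. Qed.

Lemma quotient_map_cylinder (S : set (J * I)) :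
  quotient_map (fun z : A * B * I * I => glue_pi (join_pi z.1, z.2) : collapse S).
Proof.
apply: (@quotient_map_comp _ _ _ (fun z : A * B * I * I => (join_pi z.1, z.2)) glue_pi).
  exact: quotient_map_prod unit_interval_locally_compact quotient_map_join.
exact: quotient_map_glue.
Qed.

Definition backB_thenA (p : A * B * I) : wedge_sum (susp R A) (susp R B) :=
  if set_val p.2 <= 1 / 2 :> R
  then wedge_inr (susp R A) (susp_pi (p.1.2, clamp (1 - 2 * set_val p.2)))
  else wedge_inl (susp R B) (susp_pi (p.1.1, clamp (2 * set_val p.2 - 1))).

Lemma backB_thenA_join p q : join_rel p q -> backB_thenA p = backB_thenA q.
Proof.
rewrite /backB_thenA => -[a b b'|a a' b|t t'] /=.
- rewrite set_val_i0 clamp_ge1; last lra.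
  by rewrite !susp_pi_i1 wedge_inr_point ifT//; lra.
- rewrite set_val_i1 [clamp (2 * 1 - 1)]clamp_ge1; last lra.
  by rewrite !susp_pi_i1 ifF//; apply/negbTE; rewrite -ltNge; lra.
- by rewrite !susp_pi_point !wedge_inr_point; do 2 case: ifP.
Qed.

Definition lambda : J -> wedge_sum (susp R A) (susp R B) :=
  join_lift backB_thenA.

Lemma lambdaE p : lambda (join_pi p) = backB_thenA p.
Proof. exact: join_liftE backB_thenA_join p. Qed.

(* f' and g' for the inclusions iota_1 and iota_2 of the two summands. *)
Let f := @wedge_inl (susp R A) (susp R B) \o susp_map (fst : A * B -> A).
Let g := @wedge_inr (susp R A) (susp R B) \o susp_map (snd : A * B -> B).
Let c := susp_comm f g.

Let f0 : f point = point.
Proof. by rewrite /f /= susp_map_point. Qed.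

Let g0 : g point = point.
Proof. by rewrite /g /= susp_map_point// wedge_inr_point. Qed.

Let fE p t : f (susp_pi (p, t)) = wedge_inl (susp R B) (susp_pi (p.1, t)).
Proof. by rewrite /f /= susp_mapE. Qed.

Let gE p t : g (susp_pi (p, t)) = wedge_inr (susp R A) (susp_pi (p.2, t)).
Proof. by rewrite /g /= susp_mapE. Qed.

(** The time reached at t in the r-th stage of the sliding.  For all r it stays
    in [0,1/8] at t = 0 and in [1/2,1] at t = 1, that is in the first and the
    last factor of the commutator; for r = 1 it runs from 1/8 to 1/2, at the
    speeds that match lambda on the two halves of the interval. *)
Let slide (t r : I) : R :=
  (1 - set_val r) * set_val t +
  set_val r * Num.max (set_val t / 2) (1 / 8 + set_val t / 4).

Let K (z : A * B * I * I) := c (susp_pi (z.1.1, clamp (slide z.1.2 z.2))).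

Let K_join r p q : join_rel p q -> K (p, r) = K (q, r).
Proof.
have r01 := set_val_itv r.
rewrite /K /slide => -[a b b'|a a' b|t t'] /=; last by rewrite !susp_pi_point.
- rewrite set_val_i0; set x := (X in clamp X).
  have hx : x <= 1 / 8 by rewrite /x max_r; lra.
  have [+ _ _ _] := susp_commE (a, b) x f0 g0.
  have [+ _ _ _] := susp_commE (a, b') x f0 g0.
  by rewrite -/c => -> // -> //; rewrite !fE.
- rewrite set_val_i1; set x := (X in clamp X).
  have hx : 1 / 2 <= x by rewrite /x max_l; lra.
  have [_ _ _ +] := susp_commE (a, b) x f0 g0.
  have [_ _ _ +] := susp_commE (a', b) x f0 g0.
  by rewrite -/c => -> // -> //; rewrite !gE.
Qed.

Let c0 : c point = point.
Proof. by rewrite /c /susp_comm !susp_mul_point// ?susp_inv_point. Qed.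

Definition join_to_susp : J -> susp R (A * B)%type :=
  join_lift (fun p => susp_pi p).

Lemma join_to_suspE p : join_to_susp (join_pi p) = susp_pi p.
Proof.
apply: join_liftE => _ _ [a b b'|a a' b|t t'].
- by rewrite !susp_pi_i0.
- by rewrite !susp_pi_i1.
- by rewrite !susp_pi_point.
Qed.

Lemma join_to_susp_based : based_map join_to_susp.
Proof.
split; last first.
  by rewrite join_point join_to_suspE.
apply: (quotient_map_continuous quotient_map_join).
rewrite (_ : _ \o _ = @susp_pi R _); first exact: susp_pi_continuous.
by apply/funext => p /=; rewrite join_to_suspE.
Qed.

Lemma mu'_factor z :
  mu' R A B z = susp_map (@smash_pi A B) (join_to_susp z).
Proof.
rewrite -(glue_piK z); case: (glue_repr z) => -[a b] t.
by rewrite -/(join_pi (a, b, t)) mu'E join_to_suspE susp_mapE.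
Qed.

(** Over the join, the factor f'^-1 in front of the commutator and the factor g'
    at its end can be undone: the homotopy evaluates the commutator at [slide].
    It respects the identifications at t = 0 because there the commutator is in
    its first factor, which depends on a alone, and those at t = 1 because
    there it is in its last factor, which depends on b alone. *)
Lemma comm_join_homotopic : continuous c -> homotopic R (c \o join_to_susp) lambda.
Proof.
move=> cc; pose H (z : J * I) := join_lift (fun p => K (p, z.2)) z.1.
have HE p r : H (join_pi p, r) = K (p, r) by exact: (join_liftE (@K_join r)).
apply: (@homotopic_quotient R (A * B * I)%type _ _ (@join_pi R A B) H).
- exact: quotient_map_join.
- have -> : (fun z : A * B * I * I => H (join_pi z.1, z.2)) = K.
    by apply/funext => -[p r]; exact: HE.
  apply: continuous_then cc; apply: continuous_susp_pi.
    exact: continuous_then (@continuous_fst _ _) (@continuous_fst _ _).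
  rewrite /slide.
  have ct : continuous (fun z : A * B * I * I => set_val z.1.2 : R).
    apply: continuous_then (@set_val_continuous R).
    exact: continuous_then (@continuous_fst _ _) (@continuous_snd _ _).
  have cr : continuous (fun z : A * B * I * I => set_val z.2 : R).
    exact: continuous_then (@continuous_snd _ _) (@set_val_continuous R).
  have cm : continuous (fun z : A * B * I * I =>
      Num.max (set_val z.1.2 / 2) (1 / 8 + set_val z.1.2 / 4 : R)).
    move=> z; apply: (@continuous_max R _ (fun z : A * B * I * I => set_val z.1.2 / 2)
                        (fun z : A * B * I * I => 1 / 8 + set_val z.1.2 / 4)).
      by apply: cvgM; [exact: ct|exact: cvg_cst].
    by apply: cvgD; [exact: cvg_cst|apply: cvgM; [exact: ct|exact: cvg_cst]].
  move=> z; apply: cvgD; apply: cvgM; [|exact: ct|exact: cr|exact: cm].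
  by apply: cvgB; [exact: cvg_cst|exact: cr].
- move=> p; rewrite HE /= join_to_suspE /K /slide /=.
  rewrite set_val_i0 subr0 mul1r mul0r addr0 clampK.
  by case: p.
- move=> [[a b] t]; rewrite HE lambdaE /K /slide /backB_thenA /=.
  rewrite set_val_i1 subrr mul0r add0r mul1r; have t01 := set_val_itv t.
  case: ifPn => ht.
    rewrite max_r; last lra.
    have [_ + _ _] := susp_commE (a, b) (1 / 8 + set_val t / 4) f0 g0.
    rewrite -/c => ->; last lra.
    by rewrite gE; congr (wedge_inr _ (susp_pi (_, clamp _))); lra.
  rewrite -ltNge in ht; rewrite max_l; last lra.
  have [_ _ + _] := susp_commE (a, b) (set_val t / 2) f0 g0.
  rewrite -/c => ->; last lra.
  by rewrite fE; congr (wedge_inl _ (susp_pi (_, clamp _))); lra.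
- by move=> r; rewrite join_point HE /K /= susp_pi_point c0.
Qed.

(** The commutator is continuous because it is one end of the homotopy that
    makes [ktilde] a Whitehead product map. *)
Lemma lambda_whitehead (mu : susp R (smash A B) -> J) ktilde :
  homotopy_inverse R (mu' R A B) mu -> whitehead_maps R A B ktilde ->
  homotopic R (lambda \o mu) ktilde.
Proof.
move=> [bmu' bmu _ mu'mu] [bk kc].
have cc : continuous c.
  have [H [cH _ H1 _]] := kc.
  have -> : c = (fun x => H (x, i1)) by apply/funext => x; rewrite H1.
  apply: (@continuous_then _ _ _ (fun x => (x, i1 : I)) H) => //.
  by apply: continuous_pair; [move=> x|exact: cst_continuous].
apply: (@homotopic_trans _ _ _ _ (c \o join_to_susp \o mu)).
  exact: homotopic_precomp (homotopic_sym (comm_join_homotopic cc)).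
apply: (@homotopic_trans _ _ _ _ (ktilde \o (mu' R A B \o mu))); last first.
  exact: homotopic_postcomp bk mu'mu.
apply: homotopic_sym.
rewrite (_ : _ \o (_ \o mu) = ktilde \o susp_map (@smash_pi A B) \o join_to_susp \o mu).
  by apply: homotopic_precomp => //; exact: homotopic_precomp join_to_susp_based kc.
by apply/funext => z /=; rewrite mu'_factor.
Qed.
End Join.

(** * The map Lambda and the turning of the square *)

Section Cone.
Context {R : realType} {A B : ptopologicalType}.
Local Notation I := (unit_interval R).
Local Notation J := (join_space R A B).

(** In the centred coordinates x = 2t - 1, y = 2s - 1 of the square, [turnA] and
    [turnB] are the two coordinates of the map
    (x, y) |-> (1 + r) (x + r y, y - r x) + (r^2, r^2),
    that is of a turn and scaling followed by a shift: the identity for r = 0,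
    and (2x + 2y + 1, 2y - 2x + 1) for r = 1.  The factor 1 + r makes room for
    the turn and r^2 is the largest shift that the room left allows. *)
Definition turnA (t s r : R) : R :=
  ((1 + r) * ((2 * t - 1) + r * (2 * s - 1)) + r * r + 1) / 2.
Definition turnB (t s r : R) : R :=
  ((1 + r) * ((2 * s - 1) - r * (2 * t - 1)) + r * r + 1) / 2.

(** No boundary point of the square is ever moved into the open square.  On the
    sides t = 1 and s = 1 one coordinate alone stays beyond 1; on the sides
    t = 0 and s = 0 the first or the second coordinate is outside according to
    which part of the side the point is in, and the division point depends
    on r. *)
Lemma turn_boundary (t s r : R) :
  0 <= t <= 1 -> 0 <= s <= 1 -> 0 <= r <= 1 ->
  [|| t == 0, t == 1, s == 0 | s == 1] ->
  [|| turnA t s r <= 0, 1 <= turnA t s r, turnB t s r <= 0 | 1 <= turnB t s r].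
Proof.
move=> /andP[t0 t1] /andP[s0 s1] /andP[r0 r1]; rewrite /turnA /turnB.
case/or4P => /eqP ->.
- have [h|h] := leP ((1 + r) * (2 * s - 1)) (1 - r); apply/or4P.
    by apply: Or41; nra.
  by apply: Or44; nra.
- by apply/or4P/Or42; nra.
- have [h|h] := leP (r - 1) ((1 + r) * (2 * t - 1)); apply/or4P.
    by apply: Or43; nra.
  by apply: Or41; nra.
- by apply/or4P/Or44; nra.
Qed.

Definition turn (r : I) (p : A * B * I) (s : I) : susp R A * susp R B :=
  (susp_pi (p.1.1, clamp (turnA (set_val p.2) (set_val s) (set_val r))),
   susp_pi (p.1.2, clamp (turnB (set_val p.2) (set_val s) (set_val r)))).

Lemma turn_point r t s : turn r (point, point, t) s = point.
Proof. by rewrite /turn /= !susp_pi_point. Qed.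

Lemma turn_smash_boundary r p s : [\/ p.2 = i0, p.2 = i1, s = i0 | s = i1] ->
  smash_pi (turn r p s) = point.
Proof.
move=> ps; have : [|| turnA (set_val p.2) (set_val s) (set_val r) <= 0,
    1 <= turnA (set_val p.2) (set_val s) (set_val r),
    turnB (set_val p.2) (set_val s) (set_val r) <= 0
  | 1 <= turnB (set_val p.2) (set_val s) (set_val r)].
  apply: turn_boundary; try exact: set_val_itv.
  by case: ps => ->; rewrite ?set_val_i0 ?set_val_i1 eqxx ?orbT.
rewrite /turn => /or4P[h|h|h|h]; apply: smash_piE.
- by left => /=; rewrite clamp_le0// susp_pi_i0.
- by left => /=; rewrite clamp_ge1// susp_pi_i1.
- by right => /=; rewrite clamp_le0// susp_pi_i0.
- by right => /=; rewrite clamp_ge1// susp_pi_i1.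
Qed.

(** At the final stage the map into the product already respects the join: at
    t = 0 the second coordinate, at t = 1 the first one is truncated to 1. *)
Lemma turn_join s p q : join_rel p q -> turn i1 p s = turn i1 q s.
Proof.
have s01 := set_val_itv s.
rewrite /turn /turnA /turnB => -[a b b'|a a' b|t t'] /=; last by rewrite !susp_pi_point.
- congr pair; rewrite set_val_i0 set_val_i1 clamp_ge1; last lra.
  by rewrite !susp_pi_i1.
- congr pair; rewrite set_val_i1 clamp_ge1; last lra.
  by rewrite !susp_pi_i1.
Qed.

(** Before the final stage the join is respected only in the smash product, where
    the whole boundary of the square goes to the base point. *)
Lemma turn_smash_join r s p q :
  join_rel p q -> smash_pi (turn r p s) = smash_pi (turn r q s).
Proof.
move=> -[a b b'|a a' b|t t']; last by rewrite !turn_point.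
- by rewrite !turn_smash_boundary//; constructor.
- by rewrite !turn_smash_boundary//; constructor.
Qed.

Lemma continuous_turnA (X : topologicalType) (t s r : X -> R) :
  continuous t -> continuous s -> continuous r ->
  continuous (fun x => turnA (t x) (s x) (r x)).
Proof.
move=> ct cs cr x; apply: cvgM; last exact: cvg_cst.
apply: cvgD; last exact: cvg_cst.
apply: cvgD; last by apply: cvgM; exact: cr.
apply: cvgM; first by apply: cvgD; [exact: cvg_cst|exact: cr].
apply: cvgD; [|apply: cvgM; first exact: cr].
- apply: cvgB; last exact: cvg_cst.
  by apply: cvgM; [exact: cvg_cst|exact: ct].
- apply: cvgB; last exact: cvg_cst.
  by apply: cvgM; [exact: cvg_cst|exact: cs].
Qed.

Lemma continuous_turnB (X : topologicalType) (t s r : X -> R) :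
  continuous t -> continuous s -> continuous r ->
  continuous (fun x => turnB (t x) (s x) (r x)).
Proof.
move=> ct cs cr x; apply: cvgM; last exact: cvg_cst.
apply: cvgD; last exact: cvg_cst.
apply: cvgD; last by apply: cvgM; exact: cr.
apply: cvgM; first by apply: cvgD; [exact: cvg_cst|exact: cr].
apply: cvgB; [|apply: cvgM; first exact: cr].
- apply: cvgB; last exact: cvg_cst.
  by apply: cvgM; [exact: cvg_cst|exact: cs].
- apply: cvgB; last exact: cvg_cst.
  by apply: cvgM; [exact: cvg_cst|exact: ct].
Qed.

Lemma continuous_turn :
  continuous (fun z : A * B * I * I * I => turn z.2 z.1.1 z.1.2).
Proof.
have ct : continuous (fun z : A * B * I * I * I => set_val z.1.1.2 : R).
  apply: continuous_then (@set_val_continuous R).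
  apply: continuous_then (@continuous_snd _ _).
  exact: continuous_then (@continuous_fst _ _) (@continuous_fst _ _).
have cs : continuous (fun z : A * B * I * I * I => set_val z.1.2 : R).
  apply: continuous_then (@set_val_continuous R).
  exact: continuous_then (@continuous_fst _ _) (@continuous_snd _ _).
have cr : continuous (fun z : A * B * I * I * I => set_val z.2 : R).
  exact: continuous_then (@continuous_snd _ _) (@set_val_continuous R).
have cab : continuous (fun z : A * B * I * I * I => z.1.1.1).
  apply: continuous_then (@continuous_fst _ _).
  exact: continuous_then (@continuous_fst _ _) (@continuous_fst _ _).
apply: continuous_pair; apply: continuous_susp_pi.
- exact: continuous_then cab (@continuous_fst _ _).
- exact: continuous_turnA.
- exact: continuous_then cab (@continuous_snd _ _).
- exact: continuous_turnB.
Qed.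

Definition Lambda : cone R J -> susp R A * susp R B :=
  cylinder_lift (turn i1).

Lemma LambdaE p s : Lambda (cone_pi (join_pi p, s)) = turn i1 p s.
Proof.
apply: (cylinder_liftE (z0 := point)); first exact: turn_join.
move=> {}p {}s [/= pE| /= ->].
  by rewrite (join_pi_point (@turn_join s) pE) turn_point.
have t01 := set_val_itv p.2.
by rewrite /turn /turnA /turnB set_val_i1 !clamp_ge1 ?susp_pi_i1//; lra.
Qed.

Lemma Lambda_based : based_map Lambda.
Proof.
split; last first.
  by rewrite cone_point join_point LambdaE turn_point.
apply: (quotient_map_continuous (quotient_map_cylinder (@cone_set R J))).
rewrite (_ : _ \o _ = fun z : A * B * I * I => turn i1 z.1 z.2); last first.
  by apply/funext => -[p s] /=; exact: LambdaE.
apply: (@continuous_then _ _ _ (fun z : A * B * I * I => (z, i1 : I)) _ _ continuous_turn).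
by apply: continuous_pair; [move=> x|exact: cst_continuous].
Qed.

(** On the base of the cone, one of the two coordinates of Lambda is always
    truncated to 0. *)
Lemma wedge_val_lambda z : wedge_val (lambda z) = Lambda (@cone_base R J z).
Proof.
rewrite -(glue_piK z); case: (glue_repr z) => -[a b] t.
rewrite -/(join_pi (a, b, t)) lambdaE /cone_base LambdaE /backB_thenA /turn /turnA /turnB /=.
have t01 := set_val_itv t; rewrite set_val_i0 set_val_i1.
case: ifPn => ht.
  rewrite [X in susp_pi (a, X)]clamp_le0; last lra.
  rewrite susp_pi_i0 /wedge_val /wedge_inr set_valE /=.
  by congr (_, susp_pi (_, clamp _)); lra.
rewrite -ltNge in ht; rewrite [X in susp_pi (b, X)]clamp_le0; last lra.
rewrite susp_pi_i0 /wedge_val /wedge_inl set_valE /=.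
by congr (susp_pi (_, clamp _), _); lra.
Qed.

(** For r = 0 the map [turn] followed by the projection to the smash product is
    the formula for sigma (S mu'), for r = 1 it is the one for Lambda. *)
Lemma cofiber_map_Lambda :
  homotopic R (cofiber_map Lambda) (sigma R A B \o susp_map (mu' R A B)).
Proof.
have [_ L0] := Lambda_based.
pose H (z : susp R J * I) := cylinder_lift (fun p s => smash_pi (turn z.2 p s)) z.1.
have HE p s r : H (susp_pi (join_pi p, s), r) = smash_pi (turn r p s).
  apply: (cylinder_liftE (F := fun p s => smash_pi (turn r p s)) (z0 := point)).
    by move=> {}s; exact: turn_smash_join.
  move=> {}p {}s [/= pE| /= ->|/= ->].
  - rewrite (join_pi_point (F := fun p => smash_pi (turn r p s)) _ pE);
      last exact: turn_smash_join.
    by rewrite turn_point -smash_point.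
  - by apply: turn_smash_boundary; constructor.
  - by apply: turn_smash_boundary; constructor.
have csp : continuous (@smash_pi (susp R A) (susp R B)).
  by case: (quotient_map_glue (collapse_rel (@wedge_set (susp R A) (susp R B)))).
apply: homotopic_sym.
apply: (homotopic_quotient (X := (A * B * I * I)%type)
         (p := fun z => susp_pi (join_pi z.1, z.2)) (H := H)).
- exact: quotient_map_cylinder.
- rewrite (_ : (fun z => _) =
      fun z : A * B * I * I * I => smash_pi (turn z.2 z.1.1 z.1.2)).
    exact: continuous_then continuous_turn csp.
  by apply/funext => -[[p s] r] /=; exact: HE.
- move=> [[[a b] t] s]; rewrite HE /=.
  have mu'0 : mu' R A B point = point.
    by rewrite join_point mu'E smash_piE ?susp_pi_point//; left.
  rewrite (susp_mapE _ _ mu'0) mu'E sigmaE /turn /turnA /turnB /= set_val_i0.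
  by congr (smash_pi (susp_pi (_, _), susp_pi (_, _))); rewrite -[RHS]clampK;
    congr clamp; field.
- move=> [p s]; rewrite HE cofiber_mapE// ?LambdaE// => z.
  rewrite -wedge_val_lambda /wedge_val; case: (lambda z) => w hw.
  by rewrite set_valE /=; exact: set_mem.
- by move=> r; rewrite susp_point join_point HE turn_point -smash_point.
Qed.
End Cone.

Theorem theorem3p1 (R : realType) (A B : ptopologicalType) :
  based_CW_type R A -> based_CW_type R B ->
  exists (Lambda : cone R (join_space R A B) -> (susp R A * susp R B)%type)
         (lambda : join_space R A B -> wedge_sum (susp R A) (susp R B)),
    [/\ based_map Lambda,
        forall z, wedge_val (lambda z) = Lambda (cone_base z),
        forall (mu : susp R (smash A B) -> join_space R A B)
               (ktilde : susp R (smash A B) ->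
                         wedge_sum (susp R A) (susp R B)),
          homotopy_inverse R (mu' R A B) mu ->
          whitehead_maps R A B ktilde ->
          homotopic R (lambda \o mu) ktilde
      & homotopic R (cofiber_map Lambda)
                    (sigma R A B \o susp_map (mu' R A B))].
Proof.
move=> _ _; exists Lambda, lambda; split.
- exact: Lambda_based.
- exact: wedge_val_lambda.
- exact: lambda_whitehead.
- exact: cofiber_map_Lambda.
Qed.
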